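(* Let $r_1,\dots,r_n>0$ and for $\mathbf{t}=(t_1,\dots,t_{2n})$ let \[T(\mathbf{t},t)=\Big|\sin\tfrac{t-t_1}{2}\Big|^{r_n}\cdots\Big|\sin\tfrac{t-t_n}{2}\Big|^{r_1}\Big|\sin\tfrac{t-t_{n+1}}{2}\Big|^{r_1}\cdots\Big|\sin\tfrac{t-t_{2n}}{2}\Big|^{r_n}.\] Consider the problem of minimizing $\sup_{t\in[0,2\pi]}T(\mathbf{t},t)$ over all $\mathbf{t}$ with $0\le t_1\le\dots\le t_n\le t_{n+1}\le\dots\le t_{2n}\le2\pi$ and $t_1+t_{2n}=2\pi$. Then the infimum is attained at a unique point $\mathbf{w}^*=(w_1,\dots,w_{2n})$, which satisfies $w_1+(w_{2n}-2\pi)=0$ and $0<w_1<\dots<w_{2n}<2\pi$. Furthermore $\mathbf{w}^*$ is symmetric: $w_k=2\pi-w_{2n+1-k}$ for $k=1,\dots,n$. *)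

(* Defs.v *)
From HB Require Import structures.
From mathcomp Require Import all_boot all_order all_algebra.
From mathcomp Require Import all_classical all_reals all_analysis.
Unset Printing Implicit Defensive.
Import Order.TTheory GRing.Theory Num.Theory.
Local Open Scope classical_set_scope.
Local Open Scope ring_scope.

(* 0-based exponent index: node i (0 <= i < 2n) carries exponent r_(expo_idx n i)
   (0-based), i.e. r_n,...,r_1 for i = 0..n-1 and r_1,...,r_n for i = n..2n-1. *)
Definition expo_idx (n i : nat) : nat := if (i < n)%N then (n.-1 - i)%N else (i - n)%N.

Definition Tpoly {R : realType} (n : nat) (r : nat -> R) (t : 'I_(2 * n) -> R) (x : R) : R :=
  \prod_(i < 2 * n) (`| sin ((x - t i) / 2) | `^ (r (expo_idx n i))).

Definition supT {R : realType} (n : nat) (r : nat -> R) (t : 'I_(2 * n) -> R) : R :=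
  sup [set Tpoly n r t x | x in [set x : R | 0 <= x <= 2 * pi]].

Definition feasible {R : realType} (n : nat) (t : 'I_(2 * n) -> R) : Prop :=
  (forall i : 'I_(2 * n), 0 <= t i <= 2 * pi) /\
  (forall i j : 'I_(2 * n), (i <= j)%N -> t i <= t j) /\
  (forall i j : 'I_(2 * n), val i = 0%N -> val j = (2 * n).-1 -> t i + t j = 2 * pi).

(* Main.v *)
Require Import Defs.
From HB Require Import structures.
From mathcomp Require Import all_boot all_order all_algebra ring lra zify.
From mathcomp Require Import all_classical all_reals all_analysis.
Import Order.TTheory GRing.Theory Num.Theory.
Import numFieldNormedType.Exports.
Local Open Scope classical_set_scope.
Local Open Scope ring_scope.

(* Write T(y, x) for the product with nodes y. On each arc between consecutive
   nodes log T is jointly concave in (y, x), because log |sin (./2)| is concave on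
   (0, 2 pi). If the nodes move from y to z with zero total weighted displacement,
   the motion splits into weighted squeezes c_i of the arcs; squeezing an arc
   raises T everywhere outside it, so by concavity T(y, x) < T(z, x) for x on the
   arc that is squeezed least (Abel summation with the decreasing function cot).
   A minimizer w exists by compactness. It attains its maximum on every arc, since
   otherwise stretching the arcs that miss the maximum would lower it everywhere.
   The comparison applied to w and any other t (after a rotation making the total
   displacement zero) then gives max T(w) < max T(t). Symmetry follows by applying
   uniqueness to the reflection of w. *)

(** * Inequalities for sine, cotangent, powers and finite products *)

(** Strict concavity of log sin, exponentiated: the derivative of [f] has the sign of [sin (b - x)],
    so [f] increases up to [b] and decreases after it. *)
Lemma sin_lt_tangent (R : realType) (a b : R) :
  0 < a < pi -> 0 < b < pi -> a != b ->
  sin a < sin b * expR ((a - b) * (cos b / sin b)).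
Proof.
move=> a0pi b0pi neab.
have sb := sin_gt0_pi b0pi.
have sbN0 : sin b != 0 by rewrite gt_eqF.
set q := cos b / sin b.
pose f := fun x : R => sin x * expR ((b - x) * q).
pose df := fun x : R => expR ((b - x) * q) * (sin (b - x) / sin b).
have fdf (x : R) : is_derive x 1 f (df x).
  rewrite /f; apply: is_derive_eq.
  rewrite /df /GRing.scale /= sinB /q; field.
  exact: sbN0.
have cf : continuous f.
  by move=> x; apply/differentiable_continuous/derivable1_diffP; case: (fdf x).
suff : f a < f b.
  rewrite /f subrr mul0r expR0 mulr1 -ltr_pdivlMr ?expR_gt0// -expRN => h.
  by apply: lt_le_trans h _; rewrite -mulNr opprB.
have [ab|ba|/eqP] := ltgtP a b; last by rewrite (negPf neab).
- have [c cab e] := MVT ab (fun x _ => fdf x) (continuous_subspaceT cf).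
  rewrite -subr_gt0 e mulr_gt0 ?subr_gt0// mulr_gt0 ?expR_gt0// divr_gt0//.
  by apply: sin_gt0_pi; move: cab; rewrite in_itv/=; lra.
- have [c cab e] := MVT ba (fun x _ => fdf x) (continuous_subspaceT cf).
  rewrite -subr_gt0 -opprB e -mulNr mulr_gt0 ?subr_gt0// /df -mulrN.
  rewrite mulr_gt0 ?expR_gt0// -mulNr divr_gt0// -sinN opprB.
  by apply: sin_gt0_pi; move: cab; rewrite in_itv/=; lra.
Qed.

Lemma cot_nonincreasing (R : realType) (u v : R) :
  0 < u -> u <= v -> v < pi -> cos v / sin v <= cos u / sin u.
Proof.
move=> u0 uv vpi.
have su : 0 < sin u by apply: sin_gt0_pi; lra.
have sv : 0 < sin v by apply: sin_gt0_pi; lra.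
have : 0 <= sin (v - u) by apply: sin_ge0_pi; lra.
rewrite sinB ler_pdivrMr// mulrAC ler_pdivlMr//; lra.
Qed.

Lemma norm_sin_shift (R : realType) (x : R) : `|sin (x / 2)| = `|sin ((x + 2 * pi) / 2)|.
Proof. by rewrite (_ : (x + 2 * pi) / 2 = x / 2 + pi) ?sinDpi ?normrN//; field. Qed.

Lemma cot_shift (R : realType) (x : R) :
  cos ((x + 2 * pi) / 2) / sin ((x + 2 * pi) / 2) = cos (x / 2) / sin (x / 2).
Proof.
rewrite (_ : (x + 2 * pi) / 2 = x / 2 + pi) ?sinDpi ?cosDpi; last by field.
by rewrite invrN mulrNN.
Qed.

Lemma norm_sin_lip (R : realType) (x y : R) : `| `|sin x| - `|sin y| | <= `|x - y|.
Proof.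
apply: le_trans (ler_dist_dist _ _) _.
wlog xy : x y / x <= y.
  by move=> h; have [/h//|/ltW/h] := leP x y; rewrite distrC (distrC y).
have [c _ e] := MVT_segment xy (fun x _ => is_derive_sin x)
  (continuous_subspaceT (@continuous_sin R)).
rewrite distrC e normrM (distrC x) ler_piMl// cos_max//.
Qed.

(* The threshold is explicit: below [e^(1/r)] both powers are small, above it
   the ratio of the bases is close to 1. *)
Lemma powR_unif_cont (R : realType) (r e : R) : 0 < r -> 0 < e ->
  exists2 d, 0 < d & forall a b : R, 0 <= a <= 1 -> 0 <= b <= 1 -> `|a - b| <= d ->
    `|a `^ r - b `^ r| <= e.
Proof.
move=> r0 e0.
(* This makes [1 - e] positive, so that it has a positive [r]-th root [th]. *)
wlog e1 : e e0 / e < 1.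
  move=> h; have m0 : 0 < Num.min e (1 / 2) by rewrite lt_min e0; lra.
  have m1 : Num.min e (1 / 2) < 1 by rewrite gt_min; apply/orP; right; lra.
  have [d d0 hd] := h _ m0 m1.
  exists d => // a b a01 b01 /(hd _ _ a01 b01) /le_trans; apply.
  by rewrite ge_min lexx.
have rN0 : r != 0 by rewrite gt_eqF.
have mon (x y : R) : 0 <= x -> x <= y -> x `^ r <= y `^ r.
  move=> x0 xy; apply: ge0_ler_powR; rewrite ?nnegrE ?(ltW r0)//.
  exact: le_trans xy.
have root (x : R) : 0 < x -> exists2 y, 0 < y & y `^ r = x.
  move=> x0; exists (x `^ r^-1); first by rewrite powR_gt0.
  by rewrite -powRrM mulVf// powRr1// ltW.
have [eta eta0 etaE] := root _ e0.
have [th th0 thE] : exists2 y, 0 < y & y `^ r = 1 - e by apply: root; lra.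
have th1 : th < 1.
  by rewrite ltNge; apply/negP => /(mon _ _ ler01); rewrite powR1 thE; lra.
(* For [a <= b] with [eta < b], a gap of at most [eta * (1 - th)] forces [th * b <= a], so the
   powers have ratio at least [1 - e]. *)
exists (eta * (1 - th)) => [|a b]; first by rewrite mulr_gt0//; lra.
wlog ab : a b / a <= b.
  move=> h a01 b01 hab; have [ab|/ltW ba] := leP a b; first exact: h.
  by rewrite distrC; apply: h => //; rewrite distrC.
move=> /andP[a0 a1] /andP[b0 b1].
rewrite distrC ger0_norm ?subr_ge0// => hab.
have pab : a `^ r <= b `^ r by apply: mon.
rewrite distrC ger0_norm ?subr_ge0//.
have a0' := powR_ge0 a r.
have [beta|etab] := leP b eta.
  have : b `^ r <= eta `^ r by apply: mon.
  rewrite etaE; lra.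
have tha : th * b <= a.
  have : eta * (1 - th) <= b * (1 - th) by rewrite ler_wpM2r; lra.
  lra.
have : (th * b) `^ r <= a `^ r.
  by apply: mon => //; rewrite mulr_ge0// ltW.
rewrite powRM ?(ltW th0)// thE.
have : b `^ r <= 1 by have := mon _ _ b0 b1; rewrite powR1.
have := powR_ge0 b r; nra.
Qed.

Lemma prod_unit_dist (R : realType) (N : nat) (a b : nat -> R) (e : R) :
  (forall i, (i < N)%N -> [/\ 0 <= a i <= 1, 0 <= b i <= 1 & `|a i - b i| <= e]) ->
  `|\prod_(i < N) a i - \prod_(i < N) b i| <= N%:R * e.
Proof.
elim: N => [|N IH] h; first by rewrite !big_ord0 subrr normr0 mul0r.
rewrite !big_ord_recr /=.
have [/andP[a0 a1] /andP[b0 b1] abe] := h N (ltnSn N).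
have {}IH := IH (fun i iN => h i (leqW iN)).
have a01 i : (i < N)%N -> 0 <= a i <= 1 by move=> iN; case: (h i (leqW iN)).
have pa0 : 0 <= \prod_(i < N) a i.
  by apply: prodr_ge0 => i _; case/andP: (a01 i (ltn_ord i)).
have pa1 : \prod_(i < N) a i <= 1 by apply: prodr_ile1 => i _; exact: a01.
have -> : \prod_(i < N) a i * a N - \prod_(i < N) b i * b N =
  \prod_(i < N) a i * (a N - b N) + (\prod_(i < N) a i - \prod_(i < N) b i) * b N by ring.
apply: le_trans (ler_normD _ _) _.
rewrite !normrM -natr1 mulrDl mul1r addrC lerD//.
- by apply: le_trans IH; rewrite ler_piMr// ger0_norm.
- by apply: le_trans abe; rewrite ler_piMl// ger0_norm.
Qed.

(** Seen from a point, nodes behind it have differences in [(0, 2 pi)] and nodes ahead in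
    [(- 2 pi, 0)]. A full turn reduces the second case to the first. *)
Lemma half_sin_lt_tangent (R : realType) (u v : R) :
  0 < u < 2 * pi /\ 0 < v < 2 * pi \/ - (2 * pi) < u < 0 /\ - (2 * pi) < v < 0 ->
  u != v ->
  `|sin (u / 2)| < `|sin (v / 2)| * expR ((u - v) / 2 * (cos (v / 2) / sin (v / 2))).
Proof.
wlog uv0 : u v / 0 < u < 2 * pi /\ 0 < v < 2 * pi.
  move=> h [uv|[uN vN]] neuv; first by apply: h => //; left.
  rewrite (norm_sin_shift _ u) (norm_sin_shift _ v) -cot_shift.
  have -> : u - v = (u + 2 * pi) - (v + 2 * pi) by ring.
  apply: h; [lra | left; lra |].
  by apply: contra neuv => /eqP/addIr ->.
move=> _ neuv; have -> : (u - v) / 2 = u / 2 - v / 2 by field.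
have su : 0 < sin (u / 2) by apply: sin_gt0_pi; lra.
have sv : 0 < sin (v / 2) by apply: sin_gt0_pi; lra.
rewrite !gtr0_norm//; apply: sin_lt_tangent; [lra | lra |].
by apply: contra neuv => /eqP h; apply/eqP; lra.
Qed.

Lemma half_cot_nonincreasing (R : realType) (u v : R) :
  0 < u < 2 * pi /\ 0 < v < 2 * pi \/ - (2 * pi) < u < 0 /\ - (2 * pi) < v < 0 ->
  u <= v -> cos (v / 2) / sin (v / 2) <= cos (u / 2) / sin (u / 2).
Proof.
case=> -[u0 v0] uv; first by apply: cot_nonincreasing; lra.
by rewrite -cot_shift -(cot_shift _ u); apply: cot_nonincreasing; lra.
Qed.

Lemma half_sin_norm_gt0 (R : realType) (u : R) :
  0 < u < 2 * pi \/ - (2 * pi) < u < 0 -> 0 < `|sin (u / 2)|.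
Proof.
case=> u0; last rewrite norm_sin_shift; rewrite normr_gt0 gt_eqF//;
  apply: sin_gt0_pi; lra.
Qed.

Lemma ltr_prod_one (R : realType) (N : nat) (A B : nat -> R) (i0 : nat) :
  (i0 < N)%N -> (forall i, (i < N)%N -> 0 < A i <= B i) -> A i0 < B i0 ->
  \prod_(i < N) A i < \prod_(i < N) B i.
Proof.
move=> i0N AB lt0.
rewrite (bigD1 (Ordinal i0N))//= [ltRHS](bigD1 (Ordinal i0N))//=.
have P0 : 0 < \prod_(i < N | i != Ordinal i0N) A i.
  by apply: prodr_gt0 => i _; case/andP: (AB i (ltn_ord i)).
apply: (@lt_le_trans _ _ (B i0 * \prod_(i < N | i != Ordinal i0N) A i)).
  by rewrite ltr_pM2r.
rewrite ler_pM2l; last by case/andP: (AB _ i0N) => ? ?; lra.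
by apply: ler_prod => i _; case/andP: (AB i (ltn_ord i)) => /ltW ->.
Qed.

(** The two sides differ by a sum of increments of [(c i - C) * k i], which closes up around the
    cycle. The constant [C] is free, so it can be taken as the least [c i.+1] to make all first
    factors nonnegative. *)
Lemma abel_sum_cyclic (R : realType) (N : nat) (c k : nat -> R) (C : R) :
  c N = c 0%N -> k N = k 0%N ->
  \sum_(i < N) (c i.+1 - c i) * k i = \sum_(i < N) (c i.+1 - C) * (k i - k i.+1).
Proof.
move=> cN kN; apply/eqP; rewrite -subr_eq0 -sumrB; apply/eqP.
pose g i := (c i - C) * k i.
transitivity (\sum_(i < N) (g i.+1 - g i)).
  by apply: eq_bigr => i _; rewrite /g; ring.
by rewrite -(big_mkord xpredT (fun i => g i.+1 - g i)) telescope_sumr// /g cN kN subrr.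
Qed.

(** * Cyclic node systems and the comparison inequality *)

Definition trig_prod {R : realType} (N : nat) (rho y : nat -> R) (x : R) : R :=
  \prod_(i < N) `|sin ((x - y i) / 2)| `^ rho i.

(* The extra node [y N] is the first node after a full turn, so that
   [y j, y j.+1] is the j-th arc for every j < N. *)
Definition cyclic_nodes {R : realType} (N : nat) (y : nat -> R) : Prop :=
  y N = y 0%N + 2 * pi /\ forall i, (i < N)%N -> y i <= y i.+1.

Lemma cyclic_nodes_le (R : realType) (N : nat) (y : nat -> R) (i j : nat) :
  cyclic_nodes N y -> (i <= j <= N)%N -> y i <= y j.
Proof.
move=> [_ h] /andP[]; elim: j => [|j IH]; first by rewrite leqn0 => /eqP ->.
rewrite leq_eqVlt => /predU1P[->//|ij jN].
by apply: le_trans (h j jN); apply: IH => //; exact: ltnW.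
Qed.

(** The side on which a node lies depends only on the indices. Two systems with [x] in their [j]-th
    arcs therefore fall in the same branch for every [i]. *)
Lemma arc_half_period (R : realType) (N : nat) (y : nat -> R) (j i : nat) (x : R) :
  cyclic_nodes N y -> (j < N)%N -> y j < x < y j.+1 -> (i <= N)%N ->
  if (i <= j)%N then 0 < x - y i < 2 * pi else - (2 * pi) < x - y i < 0.
Proof.
move=> cy jN xj iN; have [yN _] := cy.
have y0j : y 0%N <= y j by apply: (cyclic_nodes_le _ _ _ _ _ cy); lia.
have yjN : y j.+1 <= y N by apply: (cyclic_nodes_le _ _ _ _ _ cy); lia.
have y0i : y 0%N <= y i by apply: (cyclic_nodes_le _ _ _ _ _ cy); lia.
have yiN : y i <= y N by apply: (cyclic_nodes_le _ _ _ _ _ cy); lia.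
case: ifP => ij.
  have : y i <= y j by apply: (cyclic_nodes_le _ _ _ _ _ cy); lia.
  lra.
have : y j.+1 <= y i by apply: (cyclic_nodes_le _ _ _ _ _ cy); lia.
lra.
Qed.

(* Moving the nodes from [y] to [z] is a superposition of momentum-preserving
   squeezes of the arcs, arc [i] with strength [c i.+1]. Squeezing an arc raises
   the product outside it, so the product increases on the arc that is squeezed
   least. *)
Lemma trig_prod_lt (R : realType) (N : nat) (rho y z c : nat -> R) (j : nat) (x : R) :
  (forall i, (i < N)%N -> 0 < rho i) ->
  cyclic_nodes N y -> cyclic_nodes N z ->
  c N = c 0%N -> (forall i, (i < N)%N -> rho i * (z i - y i) = c i.+1 - c i) ->
  (j < N)%N -> (forall i, (i < N)%N -> c j.+1 <= c i.+1) ->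
  y j < x < y j.+1 -> (exists2 i, (i < N)%N & y i != z i) ->
  trig_prod N rho y x < trig_prod N rho z x.
Proof.
move=> rho0 cy cz cN zyc jN cmin xj [i0 i0N neq0].
(* Since [c j.+1] is least, the left end of arc [j] moves left and its right end moves right, so [x]
   is also inside arc [j] of [z]. The node 0 is handled through [c N = c 0]. *)
have zj : z j <= y j.
  rewrite -subr_le0 -(pmulr_rle0 _ (rho0 j jN)) zyc// subr_le0.
  case: j jN cmin {xj} => [|j] jN cmin; last by apply: cmin; exact: ltnW.
  by rewrite -cN -(prednK jN); apply: cmin; rewrite prednK.
have zj1 : y j.+1 <= z j.+1.
  have [j1N|Nj1] := ltnP j.+1 N.
    by rewrite -subr_ge0 -(pmulr_rge0 _ (rho0 _ j1N)) zyc// subr_ge0; exact: cmin.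
  have eN : j.+1 = N by lia.
  have N0 : (0 < N)%N by lia.
  rewrite eN cy.1 cz.1 lerD2r -subr_ge0 -(pmulr_rge0 _ (rho0 _ N0)) zyc//.
  by rewrite subr_ge0 -cN -eN; exact: cmin.
have xjz : z j < x < z j.+1 by lra.
have per i : (i < N)%N -> 0 < x - y i < 2 * pi /\ 0 < x - z i < 2 * pi \/
    - (2 * pi) < x - y i < 0 /\ - (2 * pi) < x - z i < 0.
  move=> iN; move: (arc_half_period _ _ _ _ i _ cy jN xj (ltnW iN)).
  move: (arc_half_period _ _ _ _ i _ cz jN xjz (ltnW iN)).
  by case: ifP => _ ? ?; [left|right].
pose k i := cos ((x - z i) / 2) / sin ((x - z i) / 2).
(* Logarithm of the tangent correction for factor [i]; it remains to see that the sum of these is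
   nonpositive. *)
pose e i := rho i * (z i - y i) * k i / 2.
have sy i : (i < N)%N -> 0 < `|sin ((x - y i) / 2)|.
  by move=> /per h; apply: half_sin_norm_gt0; case: h => -[]; [left|right].
have tan_lt i : (i < N)%N -> y i != z i ->
    `|sin ((x - y i) / 2)| `^ rho i < `|sin ((x - z i) / 2)| `^ rho i * expR (e i).
  move=> iN ne; have -> : e i = (x - y i - (x - z i)) / 2 * k i * rho i.
    by rewrite /e; ring.
  rewrite expRM -powRM ?expR_ge0// gt0_ltr_powR ?nnegrE ?rho0 ?mulr_ge0 ?expR_ge0//.
  apply: half_sin_lt_tangent; first exact: per.
  by apply: contra ne => /eqP/addrI/oppr_inj ->.
have : trig_prod N rho y x < trig_prod N rho z x * expR (\sum_(i < N) e i).
  rewrite expR_sum -big_split/=.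
  apply: (ltr_prod_one _ _ (fun i => `|sin ((x - y i) / 2)| `^ rho i)
    (fun i => `|sin ((x - z i) / 2)| `^ rho i * expR (e i)) i0) => //; last exact: tan_lt.
  move=> i iN; rewrite powR_gt0 ?sy//=.
  have [yz|/tan_lt/ltW->//] := eqVneq (y i) (z i).
  by rewrite /e yz subrr mulr0 !mul0r expR0 mulr1.
move=> /lt_le_trans; apply.
rewrite ler_piMr ?prodr_ge0//.
rewrite -expR0 ler_expR -mulr_suml pmulr_lle0 ?invr_gt0//.
under eq_bigr => i _ do rewrite zyc//.
rewrite (abel_sum_cyclic _ _ _ _ (c j.+1))//; last first.
  rewrite /k cz.1 -cot_shift; congr (cos (_ / 2) / sin (_ / 2)); ring.
apply: sumr_le0 => i _; have iN := ltn_ord i.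
(* Between nodes [j] and [j.+1] the cotangent crosses its pole at [x], but the choice of [C] kills
   exactly this term. On the other arcs the cotangent is monotone. *)
have [->|neij] := eqVneq (i : nat) j; first by rewrite subrr mul0r.
rewrite mulr_ge0_le0 ?subr_ge0 ?cmin// subr_le0.
apply: half_cot_nonincreasing; last by rewrite lerD2l lerN2; exact: cz.2.
move: (arc_half_period _ _ _ _ i _ cz jN xjz (ltnW iN)).
move: (arc_half_period _ _ _ _ i.+1 _ cz jN xjz iN).
have [ij|ij] := ltnP i j; first by rewrite (ltnW ij); left.
have -> : (i <= j)%N = false by lia.
by right.
Qed.

(** * Continuity of the product and its maximum over a period *)

Lemma uniform_threshold (R : realType) (N : nat) (P : nat -> R -> Prop) :
  (forall i d d', 0 < d' -> d' <= d -> P i d -> P i d') ->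
  (forall i, (i < N)%N -> exists2 d, 0 < d & P i d) ->
  exists2 d, 0 < d & forall i, (i < N)%N -> P i d.
Proof.
move=> Pmon; elim: N => [|N IH] h; first by exists 1.
have [d d0 hd] := IH (fun i iN => h i (leqW iN)).
have [d' d'0 hd'] := h N (ltnSn N).
have m0 : 0 < Num.min d d' by rewrite lt_min d0.
exists (Num.min d d') => // i; rewrite ltnS leq_eqVlt => /predU1P[->|iN].
  by apply: Pmon hd' => //; rewrite ge_min lexx orbT.
by apply: Pmon (hd i iN) => //; rewrite ge_min lexx.
Qed.

Lemma powR_unit (R : realType) (a r : R) : 0 <= r -> 0 <= a <= 1 -> 0 <= a `^ r <= 1.
Proof.
move=> r0 /andP[a0 a1]; rewrite powR_ge0/=.
by have := ge0_ler_powR r0 a0 ler01 a1; rewrite powR1.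
Qed.

(** Factors lie in [[0, 1]], so their errors add up. As [d] depends on neither nodes nor points,
    this yields continuity in [x], continuity of the maximum in the nodes, and control when both
    move. *)
Lemma trig_prod_unif_cont (R : realType) (N : nat) (rho : nat -> R) (e : R) :
  (forall i, (i < N)%N -> 0 < rho i) -> 0 < e ->
  exists2 d, 0 < d & forall y z x x',
    (forall i, (i < N)%N -> `|(x - y i) - (x' - z i)| <= d) ->
    `|trig_prod N rho y x - trig_prod N rho z x'| <= e.
Proof.
(* Dividing by [N.+1] keeps the quotient positive when [N] is 0. *)
move=> rho0 e0; have e'0 : 0 < e / N.+1%:R by rewrite divr_gt0// ltr0Sn.
have [|i iN|d d0 hd] := uniform_threshold R N (fun i d => forall a b : R,
    0 <= a <= 1 -> 0 <= b <= 1 -> `|a - b| <= d ->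
    `|a `^ rho i - b `^ rho i| <= e / N.+1%:R).
- by move=> i d d' _ dd' h a b a01 b01 hab; apply: h => //; exact: le_trans dd'.
- exact: powR_unif_cont (rho0 i iN) e'0.
exists d => // y z x x' hyz.
have unit (u : R) : 0 <= `|sin u| <= 1 by rewrite normr_ge0 sin_max.
apply: (@le_trans _ _ (N%:R * (e / N.+1%:R))).
  apply: (prod_unit_dist _ _ (fun i => `|sin ((x - y i) / 2)| `^ rho i)
    (fun i => `|sin ((x' - z i) / 2)| `^ rho i)) => i iN.
  have r0 := ltW (rho0 i iN).
  split; [exact: powR_unit | exact: powR_unit |].
  apply: hd => //; apply: le_trans (norm_sin_lip _ _ _) _.
  apply: le_trans (hyz i iN).
  rewrite -mulrBl normrM [`|2^-1|]ger0_norm ?invr_ge0// ler_piMr//; lra.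
rewrite mulrCA ler_piMr ?(ltW e0)// ler_pdivrMr ?ltr0Sn// mul1r ler_nat; exact: leqnSn.
Qed.

Lemma trig_prod_continuous (R : realType) (N : nat) (rho y : nat -> R) :
  (forall i, (i < N)%N -> 0 < rho i) -> continuous (trig_prod N rho y).
Proof.
move=> rho0 x; apply/cvgrPdist_le => e e0.
have [d d0 hd] := trig_prod_unif_cont _ _ _ _ rho0 e0.
apply/nbhs_ballP; exists d => //= x' xx'; apply: hd => i _.
by rewrite opprB addrA subrK; exact: ltW.
Qed.

Lemma trig_prod_periodic (R : realType) (N : nat) (rho y : nat -> R) :
  periodic (trig_prod N rho y) (2 * pi).
Proof.
move=> x; apply: eq_bigr => i _.
by rewrite addrAC -norm_sin_shift.
Qed.

Lemma trig_prod_reduce (R : realType) (N : nat) (rho y : nat -> R) (a x : R) :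
  exists2 x0, a <= x0 <= a + 2 * pi & trig_prod N rho y x0 = trig_prod N rho y x.
Proof.
have pi2 : 0 < 2 * pi :> R by rewrite mulr_gt0// pi_gt0.
have := floor_itv ((x - a) / (2 * pi)); set k := Num.floor _.
rewrite intrD ler_pdivlMr// ltr_pdivrMr// mulrDl mul1r => hk.
have per := periodicn (trig_prod_periodic R N rho y).
exists (x - k%:~R * (2 * pi)); first lra.
case: k {hk} => m.
  by rewrite -pmulrn [m%:R * _]mulr_natl -[in RHS](subrK ((2 * pi) *+ m) x) per.
by rewrite NegzE mulrNz -pmulrn mulNr opprK [m.+1%:R * _]mulr_natl per.
Qed.

Definition trig_max {R : realType} (N : nat) (rho y : nat -> R) : R :=
  sup [set trig_prod N rho y x | x in [set x : R | 0 <= x <= 2 * pi]].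

(** The window starts at an arbitrary [a] so that it can be aligned with the turn from [y 0] to
    [y N]. *)
Lemma trig_max_attained (R : realType) (N : nat) (rho y : nat -> R) (a : R) :
  (forall i, (i < N)%N -> 0 < rho i) ->
  exists2 x, a <= x <= a + 2 * pi & trig_prod N rho y x = trig_max N rho y /\
    forall x', trig_prod N rho y x' <= trig_max N rho y.
Proof.
move=> rho0; have pi2 : 0 < 2 * pi :> R by rewrite mulr_gt0// pi_gt0.
have a2 : a <= a + 2 * pi by lra.
have [c cI cmax] := EVT_max a2 (continuous_subspaceT (trig_prod_continuous _ _ _ y rho0)).
have cmax' x : trig_prod N rho y x <= trig_prod N rho y c.
  by have [x0 x0I <-] := trig_prod_reduce R N rho y a x; apply: cmax; rewrite in_itv.
suff cE : trig_prod N rho y c = trig_max N rho y.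
  exists c; first by move: cI; rewrite in_itv.
  by split => // x'; rewrite -cE.
have [c0 c0I c0E] := trig_prod_reduce R N rho y 0 c.
rewrite add0r in c0I; apply/eqP; rewrite eq_le; apply/andP; split; last first.
  apply: ge_sup; first by exists (trig_prod N rho y c0), c0.
  by move=> _ [x _ <-].
apply: ub_le_sup; last by exists c0.
by exists (trig_prod N rho y c) => _ [x _ <-].
Qed.

Lemma trig_prod_le_max (R : realType) (N : nat) (rho y : nat -> R) (x : R) :
  (forall i, (i < N)%N -> 0 < rho i) -> trig_prod N rho y x <= trig_max N rho y.
Proof. by move=> rho0; have [x0 _ [_]] := trig_max_attained _ _ _ y 0 rho0; exact. Qed.

(** The point [x'] may depend on [x]: rotations and reflections use this with [e = 0], continuity in
    the nodes uses [x' = x]. *)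
Lemma trig_max_le (R : realType) (N : nat) (rho y z : nat -> R) (e : R) :
  (forall i, (i < N)%N -> 0 < rho i) ->
  (forall x, exists x', trig_prod N rho y x <= trig_prod N rho z x' + e) ->
  trig_max N rho y <= trig_max N rho z + e.
Proof.
move=> rho0 h; have [x _ [<- _]] := trig_max_attained _ _ _ y 0 rho0.
have [x' hx'] := h x; apply: le_trans hx' _; rewrite lerD2r.
exact: trig_prod_le_max.
Qed.

Lemma trig_max_rotate (R : realType) (N : nat) (rho y : nat -> R) (a : R) :
  (forall i, (i < N)%N -> 0 < rho i) ->
  trig_max N rho (fun i => y i + a) = trig_max N rho y.
Proof.
move=> rho0; apply/eqP; rewrite eq_le; apply/andP; split.
  rewrite -[leRHS]addr0; apply: trig_max_le => // x; exists (x - a).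
  rewrite addr0 le_eqVlt; apply/orP; left; apply/eqP; apply: eq_bigr => i _.
  by congr (`|sin (_ / 2)| `^ _); ring.
rewrite -[leRHS]addr0; apply: trig_max_le => // x; exists (x + a).
rewrite addr0 le_eqVlt; apply/orP; left; apply/eqP; apply: eq_bigr => i _.
by congr (`|sin (_ / 2)| `^ _); ring.
Qed.

Lemma cyclic_nodes_rotate (R : realType) (N : nat) (y : nat -> R) (a : R) :
  cyclic_nodes N y -> cyclic_nodes N (fun i => y i + a).
Proof. by move=> [yN h]; split=> [|i iN]; [rewrite yN; ring | rewrite lerD2r h]. Qed.

Lemma trig_prod_node (R : realType) (N : nat) (rho y : nat -> R) (i : nat) :
  (forall i, (i < N)%N -> 0 < rho i) -> cyclic_nodes N y -> (0 < N)%N -> (i <= N)%N ->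
  trig_prod N rho y (y i) = 0.
Proof.
move=> rho0 [yN _] N0 iN.
have z k : (k < N)%N -> trig_prod N rho y (y k) = 0.
  move=> kN; rewrite /trig_prod (bigD1 (Ordinal kN))//= subrr mul0r sin0 normr0.
  by rewrite powR0 ?mul0r// gt_eqF// rho0.
have [/z//|Ni] := ltnP i N; have -> : i = N by lia.
by rewrite yN trig_prod_periodic z.
Qed.

Lemma locate_arc (R : realType) (N : nat) (y : nat -> R) (x : R) :
  (0 < N)%N -> y 0%N <= x <= y N -> exists2 j, (j < N)%N & y j <= x <= y j.+1.
Proof.
elim: N => // N IH _ /andP[y0 yN].
have [xN|xN] := leP x (y N); last by exists N => //; rewrite (ltW xN).
case: N IH yN xN => [|N] IH yN xN; first by exists 0%N => //; rewrite y0.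
have [//||j jN hj] := IH; first by rewrite y0.
by exists j => //; exact: leqW.
Qed.

(** The arcs have total length [2 pi], so one is nondegenerate, and no factor vanishes at its
    midpoint. *)
Lemma trig_max_gt0 (R : realType) (N : nat) (rho y : nat -> R) :
  (forall i, (i < N)%N -> 0 < rho i) -> cyclic_nodes N y -> 0 < trig_max N rho y.
Proof.
move=> rho0 cy; have [yN _] := cy.
have pi2 : 0 < 2 * pi :> R by rewrite mulr_gt0// pi_gt0.
have [j jN yj] : exists2 j, (j < N)%N & y j < y j.+1.
  apply/not_exists2P => h.
  suff yc k : (k <= N)%N -> y k <= y 0%N by have := yc N (leqnn N); lra.
  elim: k => // k IH kN; apply: le_trans (IH (ltnW kN)).
  by rewrite leNgt; apply/negP; case: (h k).
pose x := (y j + y j.+1) / 2.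
have xj : y j < x < y j.+1 by rewrite /x; lra.
apply: lt_le_trans (trig_prod_le_max _ _ _ _ x rho0).
apply: prodr_gt0 => i _; rewrite powR_gt0//; apply: half_sin_norm_gt0.
move: (arc_half_period _ _ _ _ i _ cy jN xj (ltnW (ltn_ord i))).
by case: ifP; [left|right].
Qed.

(** * Minimizers over all cyclic node systems *)

Lemma minimizer_equioscillates (R : realType) (N : nat) (rho w : nat -> R) (j : nat) :
  (forall i, (i < N)%N -> 0 < rho i) -> cyclic_nodes N w ->
  (forall y, cyclic_nodes N y -> trig_max N rho w <= trig_max N rho y) ->
  (j < N)%N ->
  exists2 x, w j < x < w j.+1 & trig_prod N rho w x = trig_max N rho w.
Proof.
move=> rho0 cw wmin jN; set M := trig_max N rho w.
have N0 : (0 < N)%N by lia.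
have M0 : 0 < M by exact: trig_max_gt0.
have leM x : trig_prod N rho w x <= M by exact: trig_prod_le_max.
have wS i : (i < N)%N -> w i <= w i.+1 by exact: cw.2.
pose low i := `[< forall x, w i <= x <= w i.+1 -> trig_prod N rho w x < M >].
(* The product vanishes at nodes while [M] is positive, so a maximum point on a closed arc is
   interior. *)
have highP i : (i < N)%N -> low i = false ->
    exists2 x, w i < x < w i.+1 & trig_prod N rho w x = M.
  move=> iN /asboolPn/existsNP[x /not_implyP[/andP[wx xw] /negP]].
  rewrite -leNgt => Mx; exists x; last by apply/eqP; rewrite eq_le leM.
  rewrite !lt_neqAle wx xw !andbT; apply/andP; split; apply/eqP => xE; move: Mx.
    by rewrite -xE trig_prod_node ?(ltnW iN)// leNgt M0.
  by rewrite xE trig_prod_node// leNgt M0.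
case lowj : (low j); last exact: highP.
exfalso.
have [g gN lowg] : exists2 g, (g < N)%N & low g = false.
  have [x xI [xM _]] := trig_max_attained _ _ _ w (w 0%N) rho0.
  rewrite -cw.1 in xI; have [g gN xg] := locate_arc _ _ _ _ N0 xI.
  by exists g => //; apply/asboolPn => /(_ x xg); rewrite xM ltxx.
(* Four constants follow: [e] is the gap below [M] on the low arcs, [d] the modulus for [e / 2], [s]
   at most half the length of any other arc, and [t] a lower bound for the weights. *)
have [|i iN|e e0 he] := uniform_threshold R N (fun i e => low i ->
    forall x, w i <= x <= w i.+1 -> trig_prod N rho w x + e <= M).
- by move=> i d d' _ dd' h li x xi; have := h li x xi; lra.
- have [/asboolP li|li] := boolP (low i); last by exists 1 => // /(elimN idP li).
  have [c cI cmax] := EVT_max (wS i iN)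
    (continuous_subspaceT (trig_prod_continuous _ _ _ w rho0)).
  exists (M - trig_prod N rho w c) => [|_ x xi].
    by rewrite subr_gt0; apply: li; move: cI; rewrite in_itv.
  by have := cmax x; rewrite in_itv/= => /(_ xi); lra.
have e20 : 0 < e / 2 by lra.
have [d d0 hd] := trig_prod_unif_cont _ _ _ _ rho0 e20.
have [|i iN|s s0 hs] := uniform_threshold R N (fun i s => low i = false ->
    2 * s <= w i.+1 - w i).
- by move=> i a b _ ab h /h; lra.
- have [li|li] := boolP (low i); first by exists 1.
  have [x xi _] := highP i iN (negbTE li).
  by exists ((w i.+1 - w i) / 2) => [|_]; lra.
have [|i iN|t t0 ht] := uniform_threshold R N (fun i t => t <= rho i).
- by move=> i a b _ ab h; exact: le_trans h.
- by exists (rho i) => //; exact: rho0.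
(* Nodes and evaluation point each move by at most [delta], hence [d / 2]; both ends of an arc may
   approach each other by [delta], hence [s]. *)
pose delta := Num.min (d / 2) s.
have delta0 : 0 < delta by rewrite lt_min s0 andbT; lra.
have deltad : 2 * delta <= d.
  have : delta <= d / 2 by rewrite ge_min lexx.
  lra.
have deltas : delta <= s by rewrite ge_min lexx orbT.
clearbody delta.
(* Stretch every arc on which the maximum is not attained by the same small amount. *)
pose b i : R := if low i then delta * t else 0.
have b0 i : 0 <= b i <= delta * t.
  by rewrite /b; case: ifP => _; rewrite lexx ?andbT mulr_ge0// ltW.
(* Arc [i] has strength [c i.+1]; the value at 0 repeats that of the last arc, which closes the
   cycle. *)
pose c k := if k is i.+1 then b i else b N.-1.
have cN : c N = c 0%N by rewrite -(prednK N0).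
have c0 k : 0 <= c k <= delta * t by case: k => [|k]; exact: b0.
have cm i : (i < N)%N -> c (i.+1 %% N)%N = b i.
  move=> iN; have [i1N|Ni1] := ltnP i.+1 N; first by rewrite modn_small.
  have eN : i.+1 = N by apply/eqP; rewrite eqn_leq iN.
  by rewrite eN modnn /= -eN.
(* Reducing modulo [N] makes the closing node move together with node 0. *)
pose D k := let m := (k %% N)%N in (c m.+1 - c m) / rho m.
have DE k : (k < N)%N -> D k = (c k.+1 - c k) / rho k by move=> kN; rewrite /D modn_small.
have Ddelta k : `|D k| <= delta.
  have mN : (k %% N < N)%N by rewrite ltn_mod.
  rewrite normrM normfV [`|rho _|]gtr0_norm ?rho0// ler_pdivrMr ?rho0//.
  apply: (@le_trans _ _ (delta * t)); last by rewrite ler_pM2l// ht.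
  by have := c0 (k %% N).+1; have := c0 (k %% N)%N; rewrite ler_norml; lra.
pose y k := w k - D k.
(* On a low arc [b] takes its largest value, so neither end moves inward. *)
have ylow i : (i < N)%N -> low i -> y i <= w i /\ w i.+1 <= y i.+1.
  move=> iN li; have bi : b i = delta * t by rewrite /b li.
  rewrite /y; split.
    rewrite lerBlDr lerDl DE//= divr_ge0 ?(ltW (rho0 _ iN))// subr_ge0 bi.
    by case/andP: (c0 i).
  rewrite lerBrDr gerDl /D cm//.
  have mN : (i.+1 %% N < N)%N by rewrite ltn_mod.
  rewrite ler_pdivrMr ?rho0// mul0r subr_le0 bi.
  by case/andP: (c0 (i.+1 %% N).+1).
have yw k : `|y k - w k| <= delta by rewrite /y addrAC subrr sub0r normrN.
have cy : cyclic_nodes N y.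
  split=> [|i iN]; first by rewrite /y cw.1 /D modnn mod0n; ring.
  have [li|/negbTE li] := boolP (low i).
    by have [? ?] := ylow i iN li; have := wS i iN; lra.
  have := hs i iN li; have := yw i; have := yw i.+1; rewrite !ler_norml; lra.
(* If no node moved, [c] would be constant, although [b j] and [b g] differ. *)
have [k0 k0N Dk0] : exists2 k, (k < N)%N & y k != w k.
  apply/not_exists2P => h.
  have cc k : (k <= N)%N -> c k = c 0%N.
    elim: k => // k IH kN; rewrite -(IH (ltnW kN)); case: (h k) => // /negP.
    rewrite negbK /y -subr_eq0 addrAC subrr sub0r oppr_eq0 DE// mulf_eq0 invr_eq0.
    by rewrite (gt_eqF (rho0 k kN)) orbF subr_eq0 => /eqP.
  have : b j = b g by rewrite -[b j]/(c j.+1) -[b g]/(c g.+1) !cc.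
  by rewrite /b lowj lowg => /eqP; rewrite gt_eqF// mulr_gt0.
have [x xI [xM _]] := trig_max_attained _ _ _ y (y 0%N) rho0.
rewrite -cy.1 in xI; have [i iN xi] := locate_arc _ _ _ _ N0 xI.
suff : trig_prod N rho y x < M by rewrite xM ltNge wmin.
have [li|/negbTE li] := boolP (low i).
  have [yi yi1] := ylow i iN li.
  (* The stretched arc may reach beyond the old one; [x'] is the point of the old arc nearest to
     [x]. The change [e / 2] stays below the gap [e]. *)
  have [x' x'i xx'] : exists2 x', w i <= x' <= w i.+1 & `|x - x'| <= delta.
    have := yw i; have := yw i.+1; rewrite !ler_norml => h1 h2.
    have wi := wS i iN.
    have [xw|wx] := ltP x (w i); first by exists (w i); rewrite ?ler_norml; lra.
    have [xw|wx'] := ltP (w i.+1) x; first by exists (w i.+1); rewrite ?ler_norml; lra.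
    by exists x; rewrite ?subrr ?normr0 ?wx// ltW.
  have : `|trig_prod N rho y x - trig_prod N rho w x'| <= e / 2.
    apply: hd => k kN; have := yw k; move: xx'; rewrite !ler_norml; lra.
  by rewrite ler_norml; have := he i iN li x' x'i; lra.
case/andP: xi; rewrite le_eqVlt => /predU1P[<- _|yx].
  by rewrite trig_prod_node// ltnW.
rewrite le_eqVlt => /predU1P[->|xy]; first by rewrite trig_prod_node.
(* On the remaining arcs [b i = 0] is the least strength, so the comparison applies to the squeeze
   from [y] back to [w]. *)
apply: lt_le_trans (leM x).
apply: (trig_prod_lt _ _ _ _ _ c i) => //.
- by move=> k kN; rewrite /y opprB addrCA subrr addr0 DE// mulrC divfK// gt_eqF// rho0.
- by move=> k kN; rewrite /= {1}/b li; case/andP: (b0 k).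
- by rewrite yx.
- by exists k0.
Qed.

Lemma trig_max_minimizer (R : realType) (N : nat) (rho : nat -> R) :
  (forall i, (i < N)%N -> 0 < rho i) -> (0 < N)%N ->
  exists2 w, cyclic_nodes N w &
    forall y, cyclic_nodes N y -> trig_max N rho w <= trig_max N rho y.
Proof.
move=> rho0 N0.
have pi2 : 0 < 2 * pi :> R by rewrite mulr_gt0// pi_gt0.
pose nodes (v : 'rV[R]_N.+1) (i : nat) : R := v ord0 (inord i).
pose box := [set v : 'rV[R]_N.+1 | forall i, `[0, 2 * pi]%classic (v ord0 i)].
(* Inside the box, the first condition forces the end nodes to be 0 and [2 * pi]. Every cyclic
   system reaches this form by rotating its first node to 0, which preserves the maximum. *)
pose ordered := [set v | nodes v N - nodes v 0%N = 2 * pi] `&`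
  \bigcap_(i in [set i | (i < N)%N]) [set v | 0 <= nodes v i.+1 - nodes v i].
have cbox : compact box 
  by apply: (@rV_compact R N.+1 (fun=> `[0, 2 * pi]%classic)) => _; exact: segment_compact.
have cn i : continuous (fun v => nodes v i) by exact: coord_continuous.
have cB i k : continuous (fun v => nodes v i - nodes v k).
  by move=> v; exact: (cvgB (cn i v) (cn k v)).
have clo : closed ordered.
  apply: closedI.
    apply: (@preimage_closed _ _ _ [set x | x = 2 * pi]) => [v _|]; first exact: cB.
    exact: closed_eq.
  apply: closed_bigI => i _.
  apply: (@preimage_closed _ _ (fun v => nodes v i.+1 - nodes v i) [set x | 0 <= x]).
    by move=> v _; exact: cB.
  exact: closed_ge.
have orderedP v : ordered v <-> cyclic_nodes N (nodes v).
  split=> -[h1 h2]; split.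
  - by move: h1 => /= h1; lra.
  - by move=> i iN; rewrite -subr_ge0; exact: h2.
  - by rewrite /= h1; ring.
  - by move=> i iN; rewrite /= subr_ge0; exact: h2.
have ex y : cyclic_nodes N y -> exists2 v, (box `&` ordered) v &
    trig_max N rho (nodes v) = trig_max N rho y.
  move=> cy; have cz := cyclic_nodes_rotate _ _ _ (- y 0%N) cy.
  pose v := \row_(i < N.+1) (y i - y 0%N).
  have vE i : (i <= N)%N -> nodes v i = y i - y 0%N.
    by move=> iN; rewrite /nodes mxE inordK.
  exists v; last first.
    rewrite -(trig_max_rotate _ _ _ y (- y 0%N) rho0) /trig_max.
    have -> // : trig_prod N rho (nodes v) = trig_prod N rho (fun i => y i - y 0%N).
    by apply/funext => x; apply: eq_bigr => i _; rewrite vE// ltnW.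
  split.
    move=> i; rewrite /= in_itv/= mxE.
    have iN : (i <= N)%N by rewrite -ltnS.
    have := cyclic_nodes_le _ _ _ 0 i cy iN.
    have := cyclic_nodes_le _ _ _ i N cy; rewrite iN leqnn cy.1 => /(_ isT); lra.
  apply/orderedP; split=> [|i iN]; first by rewrite !vE// cy.1; ring.
  by rewrite !vE//; [exact: cz.2|exact: ltnW].
have cf : continuous (fun v => trig_max N rho (nodes v)).
  move=> v; apply/(@cvgrPdist_le _ _ _ _ (nbhs_filter v)) => e e0.
  have [d d0 hd] := trig_prod_unif_cont _ _ _ _ rho0 e0.
  apply/nbhs_ballP; exists d => //= v' [_ vv'].
  have le2 (a b : 'rV[R]_N.+1) : (forall i, `|nodes a i - nodes b i| <= d) ->
      trig_max N rho (nodes a) <= trig_max N rho (nodes b) + e.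
    move=> hab; apply: trig_max_le => // x; exists x.
    have : `|trig_prod N rho (nodes a) x - trig_prod N rho (nodes b) x| <= e.
      apply: hd => i _; rewrite distrC.
      by have -> : x - nodes b i - (x - nodes a i) = nodes a i - nodes b i by ring.
    by rewrite ler_norml; lra.
  have h i : `|nodes v i - nodes v' i| <= d by exact/ltW/vv'.
  have h1 := le2 v v' h.
  have h2 : trig_max N rho (nodes v') <= trig_max N rho (nodes v) + e.
    by apply: le2 => i; rewrite distrC.
  by rewrite ler_norml; lra.
have [y0 cy0] : exists y : nat -> R, cyclic_nodes N y.
  exists (fun i => if i == 0%N then 0 else 2 * pi); split=> [|i _].
    by rewrite eqxx add0r gtn_eqF.
  by case: ifP => //= _; rewrite ltW.
have [v0 v0A _] := ex y0 cy0.
have [v vA vmin] := EVT_min_rV (ex_intro _ v0 v0A) (compact_closedI cbox clo)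
  (continuous_subspaceT cf).
exists (nodes v); first by apply/orderedP; move: vA; rewrite inE => -[].
by move=> y /ex[u uA <-]; apply: vmin; rewrite inE.
Qed.

(** The maximum is rotation invariant, so uniqueness can hold only up to a shift [a]. *)
Lemma minimizer_unique (R : realType) (N : nat) (rho w t : nat -> R) :
  (forall i, (i < N)%N -> 0 < rho i) -> (0 < N)%N ->
  cyclic_nodes N w -> cyclic_nodes N t ->
  (forall j, (j < N)%N -> exists2 x, w j < x < w j.+1 &
    trig_prod N rho w x = trig_max N rho w) ->
  trig_max N rho t <= trig_max N rho w ->
  exists a, forall i, (i < N)%N -> t i = w i + a.
Proof.
move=> rho0 N0 cw ct osc tw.
have S0 : 0 < \sum_(i < N) rho i.
  rewrite (bigD1 (Ordinal N0))//= ltr_pwDl ?rho0//.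
  by apply: sumr_ge0 => i _; exact/ltW/rho0.
(* The weighted mean displacement: after rotating by it, the total weighted displacement is zero,
   which is [c N = c 0]. *)
pose a := (\sum_(i < N) rho i * (w i - t i)) / \sum_(i < N) rho i.
pose z i := t i + a.
have cz : cyclic_nodes N z by exact: cyclic_nodes_rotate.
pose c k := \sum_(i < k) rho i * (z i - w i).
have cN : c N = c 0%N.
  rewrite /c big_ord0.
  transitivity (\sum_(i < N) (rho i * a - rho i * (w i - t i))).
    by apply: eq_bigr => i _; rewrite /z; ring.
  by rewrite sumrB -mulr_suml /a mulrCA mulfV ?mulr1 ?subrr// gt_eqF.
have [jm _ jmin] := arg_minP (fun i : 'I_N => c i.+1) (isT : xpredT (Ordinal N0)).
exists (- a) => i iN.
suff zw : w i = z i by rewrite zw /z addrK.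
apply/eqP; apply: contraTT tw => wz; rewrite -ltNge.
have [x xj <-] := osc jm (ltn_ord jm).
have -> : trig_max N rho t = trig_max N rho z by rewrite trig_max_rotate.
apply: lt_le_trans (trig_prod_le_max _ _ _ z x rho0).
apply: (trig_prod_lt _ _ _ _ _ c jm) => //; last by exists i.
  by move=> k kN; rewrite /c big_ord_recr/= [RHS]addrAC subrr add0r.
by move=> k kN; exact: (jmin (Ordinal kN)).
Qed.

(** * Return to the original problem *)

Lemma expo_idx_lt (n i : nat) : (i < 2 * n)%N -> (expo_idx n i < n)%N.
Proof. by rewrite /expo_idx; case: ifP; lia. Qed.

Lemma expo_idx_rev (n i : nat) :
  (i < 2 * n)%N -> expo_idx n (2 * n - i.+1) = expo_idx n i.
Proof. by rewrite /expo_idx; do 2! case: ifP; lia. Qed.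

(** Indices from [N] on give the first node after a full turn, as [cyclic_nodes] requires at [N];
    the value 0 only fills the case [N = 0]. *)
Definition closed_up {R : realType} (N : nat) (t : 'I_N -> R) (k : nat) : R :=
  if insub k is Some i then t i
  else if insub 0%N is Some i then t i + 2 * pi else 0.

Lemma closed_upE (R : realType) (N : nat) (t : 'I_N -> R) (i : 'I_N) :
  closed_up N t i = t i.
Proof. by rewrite /closed_up valK. Qed.

Lemma supTE (R : realType) (n : nat) (r : nat -> R) (t : 'I_(2 * n) -> R) :
  supT n r t = trig_max (2 * n) (fun i => r (expo_idx n i)) (closed_up (2 * n) t).
Proof.
rewrite /supT /trig_max.
have -> // : Tpoly n r t = trig_prod (2 * n) (fun i => r (expo_idx n i)) (closed_up (2 * n) t).
by apply/funext => x; apply: eq_bigr => i _; rewrite closed_upE.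
Qed.

Lemma closed_up_cyclic (R : realType) (n : nat) (t : 'I_(2 * n) -> R) :
  (0 < n)%N -> feasible n t -> cyclic_nodes (2 * n) (closed_up (2 * n) t).
Proof.
move=> n0 [t02 [tmon _]]; have N0 : (0 < 2 * n)%N by lia.
have tN : closed_up (2 * n) t (2 * n) = t (Ordinal N0) + 2 * pi.
  by rewrite /closed_up insubF ?ltnn// (valK (Ordinal N0) : insub 0%N = _).
split=> [|i iN]; first by rewrite tN -(closed_upE _ _ t (Ordinal N0)).
rewrite (closed_upE _ _ t (Ordinal iN)).
have [i1N|Ni1] := ltnP i.+1 (2 * n).
  by rewrite (closed_upE _ _ t (Ordinal i1N)); apply: tmon => /=.
have -> : i.+1 = (2 * n)%N by lia.
rewrite tN; have := t02 (Ordinal N0); have := t02 (Ordinal iN); lra.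
Qed.

Theorem theorem13p4 (R : realType) (n : nat) (r : nat -> R)
  (hn : (0 < n)%N) (hr : forall k : nat, (k < n)%N -> 0 < r k) :
  exists w : 'I_(2 * n) -> R,
    feasible n w /\
        (forall t, feasible n t -> supT n r w <= supT n r t) /\
        (forall t, feasible n t -> supT n r t <= supT n r w -> t = w) /\
        (forall i j : 'I_(2 * n), val i = 0%N -> val j = (2 * n).-1 -> w i + (w j - 2 * pi) = 0) /\
        (forall i : 'I_(2 * n), 0 < w i < 2 * pi) /\
        (forall i j : 'I_(2 * n), (i < j)%N -> w i < w j) /\
        (forall i j : 'I_(2 * n), (val i + val j)%N = (2 * n).-1 -> w i = 2 * pi - w j).
Proof.
set N := (2 * n)%N; pose rho i := r (expo_idx n i).
have N0 : (0 < N)%N by rewrite /N; lia.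
have NV : (N.-1 < N)%N by rewrite prednK.
have rho0 i : (i < N)%N -> 0 < rho i by move=> /expo_idx_lt/hr.
have [u cu umin] := trig_max_minimizer _ _ _ rho0 N0.
(* The rotation that makes the first and last nodes add up to [2 * pi]. *)
pose a := pi - (u 0%N + u N.-1) / 2.
pose w (i : 'I_N) := u i + a.
have ule i j : (i <= j <= N)%N -> u i <= u j by exact: cyclic_nodes_le.
have uN : u N.-1 <= u 0%N + 2 * pi.
  by rewrite -cu.1; apply: ule; rewrite leq_pred leqnn.
have fw : feasible n w.
  split=> [i|]; last split=> i j.
  - have := ule 0%N i; have := ule i N.-1.
    rewrite /= leq_pred -ltnS prednK// ltn_ord (ltnW (ltn_ord i)) => /(_ isT) h1 /(_ isT) h2.
    by rewrite /w /a; lra.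
  - by move=> ij; rewrite lerD2r; apply: ule; rewrite ij ltnW.
  - by rewrite /w => -> ->; rewrite /a -/N; field.
pose W := closed_up N w.
have WE (i : 'I_N) : W i = w i by exact: closed_upE.
have cW : cyclic_nodes N W by exact: closed_up_cyclic.
have Wmin y : cyclic_nodes N y -> trig_max N rho W <= trig_max N rho y.
  have -> : trig_max N rho W = trig_max N rho u; last exact: umin.
  rewrite -(trig_max_rotate _ _ _ u a rho0) /trig_max.
  have -> // : trig_prod N rho W = trig_prod N rho (fun i => u i + a).
  by apply/funext => x; apply: eq_bigr => i _; rewrite WE.
have peak j : (j < N)%N -> exists2 x, W j < x < W j.+1 & trig_prod N rho W x = trig_max N rho W.
  exact: minimizer_equioscillates.
have WS j : (j < N)%N -> W j < W j.+1 by move=> /peak[x /andP[wx xw] _]; exact: lt_trans xw.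
have uniq t : feasible n t -> supT n r t <= supT n r w -> t = w.
  move=> ft; rewrite !supTE => tw.
  have [b tb] := minimizer_unique _ _ _ _ _ rho0 N0 cW (closed_up_cyclic _ _ _ hn ft) peak tw.
  have tE (i : 'I_N) : t i = w i + b by rewrite -closed_upE tb// WE.
  (* Both systems satisfy the normalization of first plus last node, which leaves no freedom to
     rotate. *)
  have b0 : b = 0.
    have := ft.2.2 (Ordinal N0) (Ordinal NV) erefl erefl.
    have := fw.2.2 (Ordinal N0) (Ordinal NV) erefl erefl.
    by rewrite !tE; lra.
  by apply/funext => i; rewrite tE b0 addr0.
(* The last arc is nondegenerate, so the last node is below [w 0 + 2 * pi]; with their sum equal to
   [2 * pi] this gives positivity. *)
have w0 : 0 < w (Ordinal N0).
  have := fw.2.2 (Ordinal N0) (Ordinal NV) erefl erefl.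
  have := WS N.-1 NV; rewrite prednK// cW.1 (WE (Ordinal NV)) (WE (Ordinal N0)); lra.
exists w; split=> //; split.
  by move=> t ft; rewrite !supTE; apply: Wmin; exact: closed_up_cyclic.
split=> //; split.
  by move=> i j i0 jN; have := fw.2.2 i j i0 jN; lra.
split.
  move=> i; have h0 : w (Ordinal N0) <= w i by exact: fw.2.1.
  have h1 : w i <= w (Ordinal NV) by apply: fw.2.1; rewrite /= -ltnS prednK.
  by have := fw.2.2 (Ordinal N0) (Ordinal NV) erefl erefl; lra.
split.
  move=> i j ij; rewrite -!WE; apply: lt_le_trans (WS i _) _ => //.
  by apply: (cyclic_nodes_le _ _ _ _ _ cW); rewrite ij ltnW.
(* The exponents are palindromic, so this reflection of [w] has the same maximum and equals [w] by
   uniqueness. *)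
pose t (i : 'I_N) := 2 * pi - w (rev_ord i).
have ft : feasible n t.
  split=> [i|]; last split=> i j.
  - by have := fw.1 (rev_ord i); rewrite /t; lra.
  - by move=> ij; rewrite lerD2l lerN2; apply: fw.2.1; rewrite /= leq_sub2l.
  - move=> i0 jN; have := fw.2.2 (rev_ord j) (rev_ord i).
    rewrite /= i0 jN prednK// subnn subn1 => /(_ erefl erefl); rewrite /t; lra.
have tw : t = w.
  apply: uniq => //; rewrite !supTE -[leRHS]addr0; apply: trig_max_le => // x.
  exists (2 * pi - x); rewrite addr0 le_eqVlt; apply/orP; left; apply/eqP.
  rewrite /trig_prod [RHS](reindex_inj rev_ord_inj); apply: eq_bigr => i _.
  rewrite !closed_upE /= expo_idx_rev// -normrN -sinN /t.
  by congr (`|sin _| `^ _); field.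
move=> i j ij; have -> : j = rev_ord i by 
  by apply: val_inj; rewrite /= subnS -subn1 subnAC subn1 -ij addKn.
by rewrite -[in LHS]tw.
Qed.
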